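(* Let $K$ be a field of characteristic zero, let $n\geq 1$ be an integer, and let $P_n=K[x_1,\ldots,x_n]$. Let $G_n=\mathrm{Aut}_K(P_n)$ be the group of $K$-algebra automorphisms of $P_n$, let $D_n=\mathrm{Der}_K(P_n)$ be the Lie algebra of $K$-derivations of $P_n$, and let $\mathbb{G}_n=\mathrm{Aut}_{\mathrm{Lie}}(D_n)$ be the group of automorphisms of the Lie algebra $D_n$ over $K$. Then $\mathbb{G}_n=G_n$, where $G_n$ is identified with a subgroup of $\mathbb{G}_n$ via the canonical map; that is, the canonical group homomorphism $$G_n\to \mathbb{G}_n,\qquad \sigma\mapsto\bigl(\partial\mapsto \sigma\partial\sigma^{-1}\bigr),$$ is an isomorphism of groups.
   Context: The Lie bracket on $D_n=\mathrm{Der}_K(P_n)$ is the commutator $[\partial,\delta]=\partial\delta-\delta\partial$ (composition of maps $P_n\to P_n$). For $\sigma\in G_n$ and $\partial\in D_n$, $\sigma\partial\sigma^{-1}$ denotes the composition of maps $P_n\to P_n$, which is again a $K$-derivation of $P_n$. *)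

(* Defs.v *)
From HB Require Import structures.
From mathcomp Require Import all_boot all_algebra.
From mathcomp Require Import boolp functions.
From mathcomp Require Export mpoly.

Set Implicit Arguments.
Unset Strict Implicit.
Unset Printing Implicit Defensive.

Import GRing.Theory.
Local Open Scope ring_scope.

HB.mixin Record Lmodule_isLieAlgebra (R : comNzRingType) L
    of GRing.Lmodule R L := {
  lie : L -> L -> L;
  lie_linearl : forall y, linear (lie^~ y);
  lie_linearr : forall x, linear (lie x);
  liexx : forall x, lie x x = 0;
  lie_jacobi : forall x y z,
    lie x (lie y z) + lie y (lie z x) + lie z (lie x y) = 0
}.

#[short(type="lieAlgType")]
HB.structure Definition LieAlgebra (R : comNzRingType) :=
  {L of Lmodule_isLieAlgebra R L & GRing.Lmodule R L}.

Section AlgebraAutomorphisms.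
Variables (R : comNzRingType) (A : algType R).

(* The inverse is part of the data, but it is determined by the underlying    *)
(* map (see alg_aut_ext).                                                     *)
Record alg_aut := AlgAut {
  alg_aut_fun :> A -> A;
  alg_aut_inv : A -> A;
  alg_aut_linear : linear alg_aut_fun;
  alg_aut1 : alg_aut_fun 1 = 1;
  alg_autM : {morph alg_aut_fun : a b / a * b};
  alg_autK : cancel alg_aut_fun alg_aut_inv;
  alg_autVK : cancel alg_aut_inv alg_aut_fun
}.

HB.instance Definition _ := gen_eqMixin alg_aut.
HB.instance Definition _ := gen_choiceMixin alg_aut.

HB.instance Definition _ (s : alg_aut) :=
  GRing.isLinear.Build R A A *:%R (alg_aut_fun s) (alg_aut_linear s).
HB.instance Definition _ (s : alg_aut) :=
  GRing.isMonoidMorphism.Build A A (alg_aut_fun s) (alg_aut1 s, @alg_autM s).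

Lemma alg_aut_ext (s t : alg_aut) : s =1 t -> s = t.
Proof.
case: s t => [f g lf f1 fM fK gK] [f' g' lf' f1' fM' fK' gK'] /= eqf.
have eff' : f = f' by apply/funext.
move: lf' f1' fM' fK' gK'; rewrite -eff' => lf' f1' fM' fK' gK'.
have egg' : g = g' by apply/funext => x; rewrite -{1}(gK' x) fK.
move: fK' gK'; rewrite -egg' => fK' gK'.
by congr AlgAut; exact: Prop_irrelevance.
Qed.

Lemma alg_aut_inv_linear (s : alg_aut) : linear (alg_aut_inv s).
Proof.
by move=> a x y; apply: (can_inj (@alg_autK s)); rewrite linearP /= !alg_autVK.
Qed.

Lemma alg_aut_inv1 (s : alg_aut) : alg_aut_inv s 1 = 1.
Proof. by rewrite -{1}(alg_aut1 s) alg_autK. Qed.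

Lemma alg_aut_invM (s : alg_aut) : {morph alg_aut_inv s : a b / a * b}.
Proof.
by move=> x y; apply: (can_inj (@alg_autK s)); rewrite alg_autM !alg_autVK.
Qed.

Definition alg_autV (s : alg_aut) : alg_aut :=
  AlgAut (@alg_aut_inv_linear s) (alg_aut_inv1 s) (@alg_aut_invM s)
    (@alg_autVK s) (@alg_autK s).

Definition alg_aut_id : alg_aut :=
  @AlgAut idfun idfun (fun _ _ _ => erefl) erefl (fun _ _ => erefl)
    (fun _ => erefl) (fun _ => erefl).

Lemma alg_aut_comp_linear (s t : alg_aut) : linear (s \o t).
Proof. by move=> a x y; rewrite /= !linearP. Qed.

Lemma alg_aut_comp1 (s t : alg_aut) : (s \o t) 1 = 1.
Proof. by rewrite /= !alg_aut1. Qed.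

Lemma alg_aut_compM (s t : alg_aut) : {morph s \o t : a b / a * b}.
Proof. by move=> x y; rewrite /= !alg_autM. Qed.

Definition alg_aut_comp (s t : alg_aut) : alg_aut :=
  AlgAut (@alg_aut_comp_linear s t) (alg_aut_comp1 s t) (@alg_aut_compM s t)
    (can_comp (@alg_autK s) (@alg_autK t))
    (can_comp (@alg_autVK t) (@alg_autVK s)).

Fact alg_aut_compA : associative alg_aut_comp.
Proof. by move=> r s t; apply: alg_aut_ext. Qed.
Fact alg_aut_comp1s : left_id alg_aut_id alg_aut_comp.
Proof. by move=> s; apply: alg_aut_ext. Qed.
Fact alg_aut_comps1 : right_id alg_aut_id alg_aut_comp.
Proof. by move=> s; apply: alg_aut_ext. Qed.
Fact alg_aut_compVs : left_inverse alg_aut_id alg_autV alg_aut_comp.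
Proof. by move=> s; apply: alg_aut_ext; exact: alg_autK. Qed.
Fact alg_aut_compsV : right_inverse alg_aut_id alg_autV alg_aut_comp.
Proof. by move=> s; apply: alg_aut_ext; exact: alg_autVK. Qed.

HB.instance Definition _ := isGroup.Build alg_aut alg_aut_compA
  alg_aut_comp1s alg_aut_comps1 alg_aut_compVs alg_aut_compsV.

End AlgebraAutomorphisms.

Section LieAutomorphisms.
Variables (R : comNzRingType) (L : lieAlgType R).

(* As for alg_aut, the inverse is determined by the underlying map.           *)
Record lie_aut := LieAut {
  lie_aut_fun :> L -> L;
  lie_aut_inv : L -> L;
  lie_aut_linear : linear lie_aut_fun;
  lie_aut_lie : {morph lie_aut_fun : x y / lie x y};
  lie_autK : cancel lie_aut_fun lie_aut_inv;
  lie_autVK : cancel lie_aut_inv lie_aut_fun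
}.

HB.instance Definition _ := gen_eqMixin lie_aut.
HB.instance Definition _ := gen_choiceMixin lie_aut.

HB.instance Definition _ (s : lie_aut) :=
  GRing.isLinear.Build R L L *:%R (lie_aut_fun s) (lie_aut_linear s).

Lemma lie_aut_ext (s t : lie_aut) : s =1 t -> s = t.
Proof.
case: s t => [f g lf fL fK gK] [f' g' lf' fL' fK' gK'] /= eqf.
have eff' : f = f' by apply/funext.
move: lf' fL' fK' gK'; rewrite -eff' => lf' fL' fK' gK'.
have egg' : g = g' by apply/funext => x; rewrite -{1}(gK' x) fK.
move: fK' gK'; rewrite -egg' => fK' gK'.
by congr LieAut; exact: Prop_irrelevance.
Qed.

Lemma lie_aut_inv_linear (s : lie_aut) : linear (lie_aut_inv s).
Proof.
by move=> a x y; apply: (can_inj (@lie_autK s)); rewrite linearP /= !lie_autVK.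
Qed.

Lemma lie_aut_inv_lie (s : lie_aut) : {morph lie_aut_inv s : x y / lie x y}.
Proof.
by move=> x y; apply: (can_inj (@lie_autK s)); rewrite lie_aut_lie !lie_autVK.
Qed.

Definition lie_autV (s : lie_aut) : lie_aut :=
  LieAut (@lie_aut_inv_linear s) (@lie_aut_inv_lie s)
    (@lie_autVK s) (@lie_autK s).

Definition lie_aut_id : lie_aut :=
  @LieAut idfun idfun (fun _ _ _ => erefl) (fun _ _ => erefl)
    (fun _ => erefl) (fun _ => erefl).

Lemma lie_aut_comp_linear (s t : lie_aut) : linear (s \o t).
Proof. by move=> a x y; rewrite /= !linearP. Qed.

Lemma lie_aut_comp_lie (s t : lie_aut) : {morph s \o t : x y / lie x y}.
Proof. by move=> x y; rewrite /= !lie_aut_lie. Qed.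

Definition lie_aut_comp (s t : lie_aut) : lie_aut :=
  LieAut (@lie_aut_comp_linear s t) (@lie_aut_comp_lie s t)
    (can_comp (@lie_autK s) (@lie_autK t))
    (can_comp (@lie_autVK t) (@lie_autVK s)).

Fact lie_aut_compA : associative lie_aut_comp.
Proof. by move=> r s t; apply: lie_aut_ext. Qed.
Fact lie_aut_comp1s : left_id lie_aut_id lie_aut_comp.
Proof. by move=> s; apply: lie_aut_ext. Qed.
Fact lie_aut_comps1 : right_id lie_aut_id lie_aut_comp.
Proof. by move=> s; apply: lie_aut_ext. Qed.
Fact lie_aut_compVs : left_inverse lie_aut_id lie_autV lie_aut_comp.
Proof. by move=> s; apply: lie_aut_ext; exact: lie_autK. Qed.
Fact lie_aut_compsV : right_inverse lie_aut_id lie_autV lie_aut_comp.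
Proof. by move=> s; apply: lie_aut_ext; exact: lie_autVK. Qed.

HB.instance Definition _ := isGroup.Build lie_aut lie_aut_compA
  lie_aut_comp1s lie_aut_comps1 lie_aut_compVs lie_aut_compsV.

End LieAutomorphisms.

Section Derivations.
Variables (R : comNzRingType) (A : algType R).

Definition is_derivation (d : A -> A) : Prop :=
  linear d /\ forall a b, d (a * b) = d a * b + a * d b.

(* Boolean version of is_derivation, so that derivations form a submodule of  *)
(* the R-module A -> A in the sense of the library.                           *)
Definition derivationb : {pred A -> A} := fun d => `[< is_derivation d >].

Fact derivation_submod_closed : submod_closed derivationb.
Proof.
split=> [|c d e /asboolP [ld dM] /asboolP [le eM]]; apply/asboolP; split.
- by move=> a x y; rewrite /GRing.zero/= scaler0 addr0.
- by move=> x y; rewrite /GRing.zero/= mul0r mulr0 addr0.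
- move=> a x y; rewrite /= !fctE ld le.
  by rewrite !scalerDr !scalerA [c * a]mulrC addrACA.
- move=> x y; rewrite /= !fctE dM eM.
  by rewrite scalerDr mulrDl mulrDr scalerAl scalerAr addrACA.
Qed.

HB.instance Definition _ :=
  GRing.isSubmodClosed.Build R (A -> A) derivationb derivation_submod_closed.

Record der := Der { der_fun :> A -> A; der_subproof : der_fun \in derivationb }.

HB.instance Definition _ := [isSub for der_fun].
HB.instance Definition _ := [Choice of der by <:].
HB.instance Definition _ := [SubChoice_isSubLmodule of der by <:].

Lemma derP (d : der) : is_derivation d.
Proof. by apply/asboolP; case: d. Qed.

HB.instance Definition _ (d : der) :=
  GRing.isLinear.Build R A A *:%R (der_fun d) (derP d).1.

Lemma derM (d : der) a b : d (a * b) = d a * b + a * d b.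
Proof. exact: (derP d).2. Qed.

Lemma der_ext (d e : der) : d =1 e -> d = e.
Proof. by move=> eq_de; apply/val_inj/funext. Qed.

Lemma der0E x : (0 : der) x = 0. Proof. by []. Qed.
Lemma derDE (d e : der) x : (d + e) x = d x + e x. Proof. by []. Qed.
Lemma derZE c (d : der) x : (c *: d) x = c *: d x. Proof. by []. Qed.

Fact der_lie_subproof (d e : der) :
  (fun a => d (e a) - e (d a)) \in derivationb.
Proof.
apply/asboolP; split=> [c x y|x y].
  by rewrite !(derP _).1 scalerBr opprD addrACA.
rewrite !derM !linearD /= !derM mulrBl mulrBr -opprD.
apply/eqP; rewrite subr_eq; apply/eqP.
rewrite [RHS](AC ((2*2)*(2*2)) (1*7*6*3*(5*2)*(8*4))) /=.
by rewrite !subrr !addr0 !addrA.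
Qed.

Definition der_lie (d e : der) : der := Der (der_lie_subproof d e).

Fact der_lie_linearl (e : der) : linear (der_lie^~ e).
Proof.
move=> c d d'; apply: der_ext => x /=.
by rewrite /= linearP scalerBr opprD addrACA.
Qed.

Fact der_lie_linearr (d : der) : linear (der_lie d).
Proof.
move=> c e e'; apply: der_ext => x /=.
by rewrite /= linearP scalerBr opprD addrACA.
Qed.

Fact der_liexx (d : der) : der_lie d d = 0.
Proof. by apply: der_ext => x /=; rewrite subrr. Qed.

Fact der_lie_jacobi (d e f : der) :
  der_lie d (der_lie e f) + der_lie e (der_lie f d) + der_lie f (der_lie d e)
    = 0.
Proof.
apply: der_ext => x; rewrite !derDE der0E /= !linearB /= !opprK.
rewrite (AC (((2*2)*(2*2))*(2*2))
  ((1*11)*(8*2)*(5*3)*(4*10)*(12*6)*(9*7))) /=.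
by rewrite !subrr !addr0.
Qed.

HB.instance Definition _ := Lmodule_isLieAlgebra.Build R der
  der_lie_linearl der_lie_linearr der_liexx der_lie_jacobi.

Fact der_conj_subproof (s : alg_aut A) (d : der) :
  s \o d \o alg_aut_inv s \in derivationb.
Proof.
apply/asboolP; split=> [c x y|x y] /=.
  by rewrite alg_aut_inv_linear !linearP.
by rewrite alg_aut_invM derM linearD /= !alg_autM !alg_autVK.
Qed.

Definition der_conj (s : alg_aut A) (d : der) : der :=
  Der (der_conj_subproof s d).

Fact der_conj_linear (s : alg_aut A) : linear (der_conj s).
Proof. by move=> c d e; apply: der_ext => x; rewrite /= linearP. Qed.

Fact der_conj_lie (s : alg_aut A) :
  {morph der_conj s : d e / lie d e}.
Proof. by move=> d e; apply: der_ext => x; rewrite /= linearB /= !alg_autK. Qed.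

Fact der_conjK (s : alg_aut A) : cancel (der_conj s) (der_conj (alg_autV s)).
Proof. by move=> d; apply: der_ext => x; rewrite /= !alg_autK. Qed.

Fact der_conjVK (s : alg_aut A) : cancel (der_conj (alg_autV s)) (der_conj s).
Proof. by move=> d; apply: der_ext => x; rewrite /= !alg_autVK. Qed.

Definition conj_lie_aut (s : alg_aut A) : lie_aut der :=
  LieAut (@der_conj_linear s) (@der_conj_lie s) (@der_conjK s) (@der_conjVK s).

End Derivations.

(* Main.v *)
Require Import Defs.
From HB Require Import structures.
From mathcomp Require Import all_boot all_algebra.
From mathcomp Require Import boolp.

(** Let P be the polynomial ring, D its Lie algebra of derivations, ∂_i the
    partial derivatives and E = Σ x_i ∂_i the Euler derivation.  Injectivity of
    σ ↦ (∂ ↦ σ∂σ^-1) holds because σ(f ∂)σ^-1 = σ(f) · σ∂σ^-1 determines σ(f).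
    For surjectivity let φ be a Lie automorphism of D and δ_i = φ(∂_i); the
    point is to find coordinates y_i of P in which δ_i is the partial
    derivative with respect to y_i.

    The δ_i commute, and only their constant combinations commute with all of
    them, since this holds for the ∂_i.  Two facts about the action of the δ_i
    on P follow.
    - Every f in P is killed by all long enough products of the δ_i
      ([killed_delta]): ad δ_i sends f δ_j to δ_i(f) δ_j, and the ad ∂_i are
      jointly nilpotent on each element of D.
    - The common kernel of the δ_i is K ([delta_eq0]): if all δ_i kill f, then
      f δ_j is a constant combination of the δ_i, which a comparison of
      degrees forbids unless f is constant.
    So there is a g whose derivatives δ_i(g) are constants, some δ_j(g) = c
    being nonzero.  As [δ_k, φ(x_i ∂_j)] is δ_j for k = i and 0 otherwise,
    y_i = c^-1 φ(x_i ∂_j)(g) satisfies δ_k(y_i) = 1 for k = i and 0 otherwise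
    ([delta_dual]).  Moreover φ(E) - Σ y_i δ_i commutes with all the δ_k, so
    constants can be added to the y_i to get φ(E) = Σ y_i δ_i
    ([delta_dual_euler]).

    The substitution σ : x_i ↦ y_i intertwines ∂_i and δ_i.  It is injective
    because its kernel is stable under the ∂_i, and surjective because φ(E)
    acts, on an f killed by the products of k + 1 of the δ_i, as multiplication
    by k up to an error of lower order ([killed_euler]), whereas
    φ(E)(f) = Σ y_i δ_i(f) lies in the image of σ as soon as the δ_i(f) do.
    Finally conjugation by σ and φ agree on the ∂_i and on E, and these
    elements determine a Lie automorphism: the same approximate eigenvalue
    argument applies to ad E on D ([lie_aut_fix]). *)

Set Implicit Arguments.
Unset Strict Implicit.
Unset Printing Implicit Defensive.

Import GRing.Theory.
Local Open Scope ring_scope.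

(** * Lie algebras *)

HB.instance Definition _ (R : comNzRingType) (L : lieAlgType R) (x : L) :=
  GRing.isLinear.Build R L L *:%R (lie x) (lie_linearr x).

Section LieAlgebra.
Variables (R : comNzRingType) (L : lieAlgType R).
Implicit Types x y z : L.

Lemma lie_antisym x y : lie x y = - lie y x.
Proof.
have addl u v w : lie (u + v) w = lie u w + lie v w.
  by rewrite -[u in LHS]scale1r lie_linearl scale1r.
apply/eqP; rewrite -addr_eq0; have := liexx (x + y).
by rewrite linearD /= !addl !liexx add0r addr0 addrC => ->.
Qed.

Lemma lie_derivation x y z :
  lie x (lie y z) = lie (lie x y) z + lie y (lie x z).
Proof.
have /eqP := lie_jacobi x y z.
rewrite (lie_antisym z x) linearN /= (lie_antisym z) -addrA -opprD subr_eq0.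
by rewrite addrC => /eqP.
Qed.

End LieAlgebra.

(** * Vectors annihilated by all products of k operators *)

Section Killed.
Variables (I : Type) (R : pzRingType).

(** For the partial derivatives acting on polynomials in characteristic zero,
    this says that the polynomial has degree less than k; in general it plays
    the role of a degree filtration attached to the operators T_i. *)
Fixpoint killed (V : zmodType) (T : I -> V -> V) (k : nat) (v : V) : Prop :=
  if k is k'.+1 then forall i, killed T k' (T i v) else v = 0.

Lemma killed_image (V W : zmodType) (T : I -> V -> V) (U : I -> W -> W)
    (f : V -> W) k v :
    f 0 = 0 -> (forall i u, f (T i u) = U i (f u)) ->
  killed T k v -> killed U k (f v).
Proof.
move=> f0 fTU; elim: k v => [v ->|k IHk v kv i] //=.
by rewrite -fTU; apply/IHk/kv.
Qed.

Lemma killed_preimage (V W : zmodType) (T : I -> V -> V) (U : I -> W -> W)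
    (f : V -> W) k v :
    (forall u, f u = 0 -> u = 0) -> (forall i u, f (T i u) = U i (f u)) ->
  killed U k (f v) -> killed T k v.
Proof.
move=> f0 fTU; elim: k v => [v /f0|k IHk v kv i] //=.
by apply: IHk; rewrite fTU; apply: kv.
Qed.

(** Applying operators T_i to v as long as the result is not annihilated by all
    of them stops exactly one step above the common kernel. *)
Lemma killed2_exists (V : zmodType) (T : I -> V -> V) k v :
    (forall i, T i 0 = 0) -> killed T k v -> ~ killed T 1 v ->
  exists2 w, killed T 2 w & ~ killed T 1 w.
Proof.
move=> T0; elim: k v => [v -> []|k IHk v kv nv] /=; first exact: T0.
have [allT|] := pselect (forall i, killed T 1 (T i v)); first by exists v.
by move=> /existsNP[i]; apply: IHk; apply: kv.
Qed.

(** If e is an Euler operator for the T_i and has eigenvalue a on their common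
    kernel, then the commutation T_i e = (e + 1) T_i makes the eigenvalue grow
    by one with each step of the filtration. *)
Lemma killed_euler (V : lmodType R) (T : I -> V -> V) (e : V -> V) (a : R) k v :
    (forall i, linear (T i)) -> (forall u, killed T 1 u -> e u = a *: u) ->
    (forall i u, T i (e u) = e (T i u) + T i u) ->
  killed T k.+1 v -> killed T k (e v - (a + k%:R) *: v).
Proof.
move=> linT e1 eT; elim: k v => [v /e1 ->|k IHk v kv i] /=.
  by rewrite addr0 subrr.
rewrite addrC -scaleNr linT eT addrC.
(* The summand T_i v lowers the eigenvalue from a + k + 1 to a + k. *)
suff -> : e (T i v) + T i v + - (a + k.+1%:R) *: T i v
          = e (T i v) - (a + k%:R) *: T i v by apply: IHk.
rewrite -natr1 addrA scaleNr [in LHS]scalerDl scale1r opprD.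
by rewrite addrA addrAC addrK.
Qed.

End Killed.

(** * The module of derivations of a commutative algebra *)

Section DerivationModule.
Variables (R : comNzRingType) (A : comAlgType R).
Implicit Types (f g : A) (d e : der A) (s : alg_aut A).

Lemma lie_derE d e f : lie d e f = d (e f) - e (d f). Proof. by []. Qed.

Lemma der_sumE (I : Type) (r : seq I) (P : pred I) (F : I -> der A) f :
  (\sum_(i <- r | P i) F i) f = \sum_(i <- r | P i) F i f.
Proof. by elim/big_rec2: _ => // i y x _ <-. Qed.

Lemma der1 d : d 1 = 0.
Proof. by apply: (addrI (d 1)); rewrite addr0 -{3}[1]mulr1 derM mulr1 mul1r. Qed.

Lemma der_alg d c : d c%:A = 0.
Proof. by rewrite linearZ /= der1 scaler0. Qed.

Fact der_scale_subproof f d : (fun a => f * d a) \in derivationb (A := A).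
Proof.
apply/asboolP; split=> [c x y|x y].
  by rewrite linearP mulrDr scalerAr.
by rewrite derM mulrDr !mulrA [x * f]mulrC.
Qed.

Definition der_scale f d : der A := Der (der_scale_subproof f d).

Lemma der_scaleE f d g : der_scale f d g = f * d g. Proof. by []. Qed.

Lemma der_scale0l d : der_scale 0 d = 0.
Proof. by apply: der_ext => g; rewrite der_scaleE mul0r. Qed.

Lemma der_scale0r f : der_scale f 0 = 0.
Proof. by apply: der_ext => g; rewrite der_scaleE der0E mulr0. Qed.

Lemma der_scale1 d : der_scale 1 d = d.
Proof. by apply: der_ext => g; rewrite der_scaleE mul1r. Qed.

Lemma der_scaleDl f g d : der_scale (f + g) d = der_scale f d + der_scale g d.
Proof. by apply: der_ext => h; rewrite derDE !der_scaleE mulrDl. Qed.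

Lemma der_scale_alg c d : der_scale c%:A d = c *: d.
Proof. by apply: der_ext => h; rewrite derZE der_scaleE mulr_algl. Qed.

Lemma lie_der_scale d f e :
  lie d (der_scale f e) = der_scale (d f) e + der_scale f (lie d e).
Proof.
apply: der_ext => x.
by rewrite derDE !lie_derE !der_scaleE derM lie_derE mulrBr addrA.
Qed.

Lemma der_conj_scale s f d :
  der_conj s (der_scale f d) = der_scale (s f) (der_conj s d).
Proof. by apply: der_ext => x; rewrite /= alg_autM. Qed.

End DerivationModule.

(** * Derivations of a polynomial ring *)

Section PolynomialRing.
Variables (K : comNzRingType) (n : nat).
Local Notation P := {mpoly K[n]}.
Implicit Types (p q : P) (d e : der P).

Lemma mpoly_gen_ind (Q : P -> Prop) :
    (forall c, Q c%:MP) -> (forall i, Q 'X_i) ->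
    (forall p q, Q p -> Q q -> Q (p + q)) ->
    (forall p q, Q p -> Q q -> Q (p * q)) ->
  forall p, Q p.
Proof.
move=> QC QX QD QM; elim/mpolyind => [|c m p _ _ Qp].
  by rewrite -mpolyC0.
apply: (QD _ _ _ Qp); rewrite -mul_mpolyC; apply: (QM) => //.
rewrite mpolyXE_id.
apply: (big_ind Q) => [|p1 p2|i _]; [by rewrite -mpolyC1|exact: (QM)|].
by elim: (m i) => [|k IHk]; rewrite ?expr0 -?mpolyC1 // exprS; apply: QM.
Qed.

Lemma comp_mpolyM (t : n.-tuple P) : {morph comp_mpoly t : p q / p * q}.
Proof. exact: rmorphM. Qed.

Lemma derC d c : d c%:MP = 0.
Proof. by rewrite -alg_mpolyC der_alg. Qed.

Lemma der_extX d e : (forall i, d 'X_i = e 'X_i) -> d = e.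
Proof.
move=> deX; apply: der_ext; elim/mpoly_gen_ind => // [c|p q|p q].
- by rewrite !derC.
- by rewrite !linearD /= => -> ->.
- by rewrite !derM => -> ->.
Qed.

Fact partial_subproof i : mderiv i \in derivationb (A := P).
Proof.
apply/asboolP; split=> [|p q]; [exact: mderiv_is_linear|exact: mderivM].
Qed.

Definition partial i : der P := Der (partial_subproof i).

Lemma partialE i p : partial i p = p^`M(i). Proof. by []. Qed.

Lemma partialX i j : partial i 'X_j = (i == j)%:R.
Proof.
rewrite partialE mderivX mnm1E eq_sym.
case: eqP => [->|]; last by rewrite scale0r.
by rewrite -{1}[U_(j)%MM]add0m addmK mpolyX0 scale1r.
Qed.

Lemma sum_partialX (f : 'I_n -> P) j :
  (\sum_i der_scale (f i) (partial i)) 'X_j = f j.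
Proof.
rewrite der_sumE (bigD1 j) // big1 => [|i ij].
  by rewrite /= -partialE partialX eqxx mulr1 addr0.
by rewrite der_scaleE partialX (negbTE ij) mulr0.
Qed.

Lemma der_sum_partial d : d = \sum_i der_scale (d 'X_i) (partial i).
Proof. by apply: der_extX => j; rewrite sum_partialX. Qed.

Lemma lie_partial i j : lie (partial i) (partial j) = 0.
Proof. by apply: der_ext => p; rewrite lie_derE !partialE mderiv_comm subrr. Qed.

Lemma lie_partialX i d j : lie (partial i) d 'X_j = partial i (d 'X_j).
Proof.
by rewrite lie_derE partialX -mpolyC_nat derC subr0.
Qed.

Lemma killed_partial_msize k p :
  (msize p <= k)%N -> killed (fun i => partial i) k p.
Proof.
elim: k p => [p|k IHk p sp i] /=.
  by rewrite leqn0 msize_poly_eq0 => /eqP.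
apply: IHk; rewrite mmeasureE; apply/bigmax_leqP_seq => m + _.
rewrite mcoeff_msupp mcoeff_deriv => pm.
rewrite -ltnS -[X in (X < _)%N]/(mdeg m).+1.
apply: leq_trans sp; have := @msize_mdeg_lt _ _ p (m + U_(i))%MM.
rewrite mdegD mdeg1 addn1; apply; rewrite mcoeff_msupp.
by apply: contra_neq pm => ->; rewrite mul0rn.
Qed.

(** The operator ad ∂_i differentiates the coefficients d(x_j) of d. *)
Lemma killed_lie_partial d : exists k, killed (fun i => lie (partial i)) k d.
Proof.
have [k kd] : exists k, forall j, killed (fun i => partial i) k (d 'X_j).
  exists (\max_(j < n) msize (d 'X_j)) => j.
  by apply/killed_partial_msize/(leq_bigmax (F := fun j => msize (d 'X_j))).
exists k; elim: k d kd => [|k IHk] d kd /=.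
  by apply: der_extX => j; rewrite der0E; apply: kd.
by move=> i; apply: IHk => j; rewrite lie_partialX; apply: kd.
Qed.

Definition euler : der P := \sum_i der_scale 'X_i (partial i).

Lemma lie_partial_euler i : lie (partial i) euler = partial i.
Proof. by apply: der_extX => j; rewrite lie_partialX sum_partialX. Qed.

Lemma lie_partial_coord i j k :
  lie (partial k) (der_scale 'X_i (partial j)) = (k == i)%:R *: partial j.
Proof.
rewrite lie_der_scale lie_partial partialX der_scale0r addr0.
by rewrite -mpolyC_nat -alg_mpolyC der_scale_alg.
Qed.

Lemma der_comp_mpoly d (t : n.-tuple P) i :
    (forall j, d (tnth t j) = (i == j)%:R) ->
  forall p, d (p \mPo t) = partial i p \mPo t.
Proof.
move=> dt; elim/mpoly_gen_ind => [c|j|p q|p q].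
- by rewrite comp_mpolyC !derC comp_mpoly0.
- by rewrite comp_mpolyXU -tnth_nth dt partialX -mpolyC_nat comp_mpolyC.
- by rewrite !linearD /= => -> ->.
- by rewrite comp_mpolyM !derM linearD /= !comp_mpolyM => -> ->.
Qed.

(** Conjugation by s turns the operator f d into s(f) times the conjugate of d,
    so the factor s(f) can be read off once that conjugate takes the value 1;
    for d = ∂_i it does so at s(x_i). *)
Lemma conj_lie_aut_inj (i : 'I_n) : injective (@conj_lie_aut K P).
Proof.
move=> s t eq_st; apply: alg_aut_ext => p.
have eq_conj d : der_conj s d = der_conj t d.
  exact: (congr1 (fun u : lie_aut _ => u d) eq_st).
have := congr1 (fun d : der P => d (s 'X_i))
  (eq_conj (der_scale p (partial i))).
rewrite !der_conj_scale !der_scaleE -eq_conj /= alg_autK -partialE partialX.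
by rewrite eqxx alg_aut1 !mulr1.
Qed.

End PolynomialRing.

(** * Characteristic zero: rigidity of the partial derivatives *)

Section CharacteristicZero.
Variables (K : fieldType) (n : nat).
Local Notation P := {mpoly K[n]}.
Implicit Types (p q : P) (d e : der P).
Local Notation partial := (@partial K n).
Local Notation euler := (@euler K n).

Hypothesis charK : [pchar K] =i pred0.

Lemma natSr_neq0 k : k.+1%:R != 0 :> K.
Proof. by rewrite (GRing.pcharf0P _).1. Qed.

Lemma partial_eq0 p : (forall i, partial i p = 0) -> p = (p@_0%MM)%:MP.
Proof.
move=> p0; apply/mpolyP => m; rewrite mcoeffC.
have [->|m0] := eqVneq; first by rewrite mulr1.
rewrite mulr0; have /existsP[i mi] : [exists i, m i != 0%N].
  apply: contraNT m0 => /existsPn m0; apply/eqP/mnmP => i.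
  by rewrite mnm0E; apply/eqP; rewrite -[_ == _]negbK.
have /(congr1 (mcoeff (m - U_(i)))) := p0 i.
rewrite partialE mcoeff_deriv mcoeff0 submK ?lep1mP // -mulr_natr.
by move/eqP; rewrite mulf_eq0 (negbTE (natSr_neq0 _)) orbF => /eqP.
Qed.

Lemma lie_partial_eq0 d : (forall i, lie (partial i) d = 0) ->
  exists c : 'I_n -> K, d = \sum_i c i *: partial i.
Proof.
move=> d0; exists (fun i => (d 'X_i)@_0%MM); rewrite {1}[d]der_sum_partial.
apply: eq_bigr => i _; apply: der_ext => p.
rewrite der_scaleE derZE -mul_mpolyC -partial_eq0 // => j.
by rewrite -lie_partialX d0.
Qed.

Lemma lie_euler_killed d : (forall i, lie (partial i) d = 0) ->
  lie euler d = - d.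
Proof.
case/lie_partial_eq0 => c ->; rewrite linear_sum -sumrN; apply: eq_bigr => i _.
by rewrite linearZ /= lie_antisym lie_partial_euler scalerN.
Qed.

(** Elements annihilated by every ad ∂_i are combinations of the ∂_i, hence
    fixed.  For d annihilated by all products of k + 1 of the ad ∂_i, with
    k > 0, induction on k shows that the difference c = u(d) - d
    commutes with all the ∂_i, so that [E, c] = -c.  On the other hand u fixes
    [E, d] - (k - 1) d, which is annihilated by products of k of the ad ∂_i;
    hence [E, c] = (k - 1) c, and k c = 0. *)
Lemma lie_aut_fix (u : lie_aut (der P)) :
  (forall i, u (partial i) = partial i) -> u euler = euler -> forall d, u d = d.
Proof.
move=> u_part u_euler d; have [k] := killed_lie_partial d.
elim: k d => [d ->|[|k] IHk d kd]; first exact: linear0.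
  have [c ->] := lie_partial_eq0 kd; rewrite linear_sum; apply: eq_bigr => i _.
  by rewrite linearZ /= u_part.
have ud0 : lie euler (u d - d) = - (u d - d).
  apply: lie_euler_killed => i.
  by rewrite linearB /= -{1}(u_part i) -lie_aut_lie IHk ?subrr //; apply: kd.
have : killed (fun i => lie (partial i)) k.+1
              (lie euler d - (- 1 + k.+1%:R) *: d).
  apply: killed_euler => // [i|e e0|i e].
  - exact: lie_linearr.
  - by rewrite lie_euler_killed // scaleN1r.
  - by rewrite lie_derivation lie_partial_euler addrC.
move/IHk; rewrite linearB linearZ /= lie_aut_lie u_euler => eq_u.
apply/eqP; rewrite -subr_eq0; move: ud0; rewrite linearB /=.
have -> : lie euler (u d) =
          lie euler d - (- 1 + k.+1%:R) *: d + (- 1 + k.+1%:R) *: u d.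
  by rewrite -eq_u subrK.
rewrite addrC addrA addKr addrC -scalerBr scalerDl scaleN1r.
move/eqP; rewrite -subr_eq0 addrAC subrr add0r scaler_eq0.
by rewrite (negbTE (natSr_neq0 _)).
Qed.

(** * Straightening the image of the partial derivatives *)

Section Frame.
Variables (phi : lie_aut (der P)) (i0 : 'I_n).
Local Notation delta i := (phi (partial i)).

Lemma lie_delta i j : lie (delta i) (delta j) = 0.
Proof. by rewrite -lie_aut_lie lie_partial linear0. Qed.

Lemma delta_neq0 i : delta i <> 0.
Proof.
rewrite -(linear0 phi) => /(can_inj (@lie_autK _ _ phi)).
move=> /(congr1 (fun d : der P => d 'X_i)); rewrite partialX eqxx der0E.
by move/eqP; rewrite oner_eq0.
Qed.

Lemma lie_delta_eq0 d : (forall i, lie (delta i) d = 0) ->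
  exists c : 'I_n -> K, d = \sum_i c i *: delta i.
Proof.
move=> d0; have [i|c dc] := @lie_partial_eq0 (lie_aut_inv phi d).
  apply: (can_inj (@lie_autK _ _ phi)).
  by rewrite lie_aut_lie lie_autVK d0 linear0.
exists c; rewrite -[LHS](lie_autVK phi) dc linear_sum.
by apply: eq_bigr => i _; rewrite linearZ.
Qed.

(** Since the δ_j commute, f ↦ f δ_j is an injection of P into D that
    intertwines δ_i and ad δ_i; the latter corresponds to ad ∂_i under φ. *)
Lemma killed_delta p : exists k, killed (fun i => delta i) k p.
Proof.
pose scale p := der_scale p (delta i0).
have [k kd] := killed_lie_partial (lie_aut_inv phi (scale p)); exists k.
apply: (@killed_preimage _ _ _ _ (fun i => lie (delta i)) scale) => [q||].
- move=> q0; have [//|q_neq0] := eqVneq q 0; case: (@delta_neq0 i0).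
  apply: der_ext => r; apply/eqP; have /eqP := congr1 (fun d : der P => d r) q0.
  by rewrite der_scaleE der0E mulf_eq0 (negbTE q_neq0).
- by move=> i q; rewrite /scale lie_der_scale lie_delta der_scale0r addr0.
rewrite -[scale p](lie_autVK phi); apply: killed_image kd; first exact: linear0.
by move=> i d; rewrite lie_aut_lie.
Qed.

(** If all the δ_i kill p, then p δ_i is a constant combination of the δ_k.
    When the degree of δ_i(x_j) is the largest among all coefficients of the
    δ_k, this bounds the degree of p δ_i(x_j) by that of δ_i(x_j). *)
Lemma delta_eq0 p : (forall i, delta i p = 0) -> p = (p@_0%MM)%:MP.
Proof.
move=> p0; have [->|p_neq0] := eqVneq p 0; first by rewrite mcoeff0 mpolyC0.
pose F (ij : 'I_n * 'I_n) := delta ij.1 'X_ij.2.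
case: (@arg_maxnP _ (i0, i0) predT (fun ij => msize (F ij))) => // -[i j] _ maxF.
have Fij_neq0 : F (i, j) != 0.
  apply/eqP => F0; case: (@delta_neq0 i0); apply: der_extX => k.
  apply/eqP; rewrite der0E -msize_poly_eq0 -leqn0 -(@msize0 n K) -F0.
  exact: (maxF (i0, k)).
have [k|c pdelta] := @lie_delta_eq0 (der_scale p (delta i)).
  by rewrite lie_der_scale lie_delta p0 der_scale0l der_scale0r addr0.
apply: msize1_polyC; rewrite -(leq_add2r (msize (F (i, j)))) add1n.
rewrite -[leqLHS]prednK; last by rewrite addn_gt0 !lt0n !msize_poly_eq0 p_neq0.
rewrite ltnS -msizeM // /F /= -der_scaleE pdelta der_sumE.
apply: leq_trans (msize_sum _ _ _) _; apply/bigmax_leqP => k _.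
by rewrite derZE (leq_trans (msizeZ_le _ _)) //; apply: (maxF (k, j)).
Qed.

(** The elements φ(x_i ∂_j) span a copy of gl_n that acts on the space of g
    with constant derivatives; starting from a single nonconstant g, it
    produces all the coordinates. *)
Lemma delta_dual : exists y : 'I_n -> P, forall i j, delta i (y j) = (i == j)%:R.
Proof.
have [k kX] := killed_delta 'X_i0.
have [||g g2 g1] := killed2_exists _ kX.
- by move=> i; apply: linear0.
- move=> /delta_eq0 /(congr1 (partial i0)); rewrite derC partialX eqxx.
  by apply/eqP/oner_neq0.
have [c gE] : exists c : 'I_n -> K, forall i, delta i g = (c i)%:MP.
  exists (fun i => (delta i g)@_0%MM) => i.
  by apply: delta_eq0 => j; apply: g2.
move/existsNP: g1 => [j /= gj].
have cj : c j != 0 by apply/eqP => cj; case: gj; rewrite gE cj mpolyC0.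
exists (fun i => (c j)^-1 *: phi (der_scale 'X_i (partial j)) g) => i k'.
rewrite linearZ /=.
have := lie_derE (delta i) (phi (der_scale 'X_k' (partial j))) g.
rewrite -lie_aut_lie lie_partial_coord linearZ derZE !gE derC subr0 => <-.
by rewrite -alg_mpolyC !scalerA mulrAC mulVf // mul1r alg_mpolyC mpolyC_nat.
Qed.

(** The y_i are determined up to additive constants, which are fixed by the
    image of the Euler derivation. *)
Lemma delta_dual_euler : exists2 y : 'I_n -> P,
  (forall i j, delta i (y j) = (i == j)%:R) &
  phi euler = \sum_i der_scale (y i) (delta i).
Proof.
have [y yP] := delta_dual.
pose e := \sum_i der_scale (y i) (delta i).
have [i|c /eqP] := @lie_delta_eq0 (phi euler - e).
  rewrite linearB /= -lie_aut_lie lie_partial_euler linear_sum (bigD1 i) //=.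
  rewrite lie_der_scale lie_delta yP eqxx der_scale1 der_scale0r addr0.
  rewrite big1 ?addr0 ?subrr // => j ij; rewrite lie_der_scale lie_delta yP.
  by rewrite eq_sym (negbTE ij) der_scale0l der_scale0r addr0.
rewrite subr_eq => /eqP ->; exists (fun i => c i *: 1 + y i) => [i j|].
  by rewrite linearD /= der_alg add0r yP.
by rewrite -big_split; apply: eq_bigr => i _; rewrite der_scaleDl der_scale_alg.
Qed.

Lemma delta_alg_aut (y : 'I_n -> P) :
    (forall i j, delta i (y j) = (i == j)%:R) ->
    phi euler = \sum_i der_scale (y i) (delta i) ->
  exists2 s : alg_aut P,
    forall i, s 'X_i = y i & forall i p, delta i (s p) = s (partial i p).
Proof.
move=> yP yE; pose t := [tuple y j | j < n]; pose s p := p \mPo t.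
have sX j : s 'X_j = y j by rewrite /s comp_mpolyXU -tnth_nth tnth_mktuple.
have sL : linear s by move=> c p q; rewrite /s linearP.
have sM : {morph s : p q / p * q} by apply: comp_mpolyM.
have s_delta i p : delta i (s p) = s (partial i p).
  by apply: der_comp_mpoly => j; rewrite tnth_mktuple.
have s_ker p : s p = 0 -> p = 0.
  move: (msize p) (killed_partial_msize (leqnn (msize p))) => k.
  elim: k p => // k IHk q qk sq0.
  have qC : q = (q@_0%MM)%:MP.
    by apply: partial_eq0 => i; apply: IHk => //; rewrite -s_delta sq0 linear0.
  by move: sq0; rewrite qC /s comp_mpolyC.
have s_inj : injective s.
  move=> p q spq; apply/eqP; rewrite -subr_eq0; apply/eqP/s_ker.
  by rewrite /s comp_mpolyB -!/(s _) spq subrr.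
have s_surj p : exists q, s q = p.
  have [k] := killed_delta p; elim: k p => [p ->|[|k] IHk p pk].
  - by exists 0; apply: comp_mpoly0.
  - by exists (p@_0%MM)%:MP; rewrite /s comp_mpolyC -delta_eq0.
  have /choice [q qP] : forall i, exists q, s q = delta i p.
    by move=> i; apply: IHk; apply: pk.
  have [|r rP] := IHk (phi euler p - (0 + k.+1%:R) *: p).
    apply: (@killed_euler _ _ _ _ (phi euler)) => // [i|r r0|i r].
    - exact: (derP (delta i)).1.
    - by rewrite (delta_eq0 r0) derC scale0r.
    rewrite -[X in _ = _ + X](_ : lie (delta i) (phi euler) r = _).
      by rewrite lie_derE addrC subrK.
    by rewrite -lie_aut_lie lie_partial_euler.
  (* Here (k + 1) p = φ(E)(p) - s(r) and φ(E)(p) = Σ y_i δ_i(p). *)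
  exists (k.+1%:R^-1 *: (\sum_i 'X_i * q i - r)).
  rewrite /s comp_mpolyZ comp_mpolyB linear_sum /= -/(s r) rP yE der_sumE.
  rewrite add0r opprB addrCA (eq_bigr (fun i => der_scale (y i) (delta i) p)).
    by rewrite subrr addr0 scalerA mulVf ?scale1r // natSr_neq0.
  by move=> i _; rewrite -/(s _) sM sX qP.
have /choice [s' s'K] := s_surj.
have sK : cancel s s' by move=> p; apply: s_inj.
by exists (AlgAut sL (comp_mpoly1 _) sM sK s'K).
Qed.

(** With s : x_i ↦ y_i as above, φ followed by conjugation by s^-1 fixes the
    ∂_i and E, hence is the identity. *)
Lemma lie_aut_conj : exists s : alg_aut P, conj_lie_aut s = phi.
Proof.
have [y yP yE] := delta_dual_euler.
have [s sX s_delta] := delta_alg_aut yP yE.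
have conj_partial i : der_conj s (partial i) = delta i.
  by apply: der_ext => p; rewrite /= -s_delta alg_autVK.
have conj_euler : der_conj s euler = phi euler.
  rewrite yE -[der_conj s]/(conj_lie_aut s : _ -> _) linear_sum.
  by apply: eq_bigr => i _; rewrite /= der_conj_scale sX conj_partial.
exists s; apply: lie_aut_ext => d.
pose u := lie_aut_comp (lie_autV (conj_lie_aut s)) phi.
have ud : u d = d.
  apply: lie_aut_fix => [i|]; rewrite /u /=.
    by rewrite -conj_partial der_conjK.
  by rewrite -conj_euler der_conjK.
by rewrite -[in LHS]ud; apply: der_conjVK.
Qed.

End Frame.

End CharacteristicZero.

Theorem theorem1p1 (K : fieldType) (n : nat)
    (charK : [pchar K] =i pred0) (n_gt0 : (0 < n)%N) :
  {morph (@conj_lie_aut K {mpoly K[n]}) : s t / (s * t)%g} /\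
  bijective (@conj_lie_aut K {mpoly K[n]}).
Proof.
pose i0 := Ordinal n_gt0.
split=> [s t|]; first by apply: lie_aut_ext => d; apply: der_ext.
have /choice [g gK] := fun phi => @lie_aut_conj K n charK phi i0.
by exists g => // s; apply: (conj_lie_aut_inj i0).
Qed.
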